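(* Let $\varepsilon>0$ be arbitrary. Then there exists a unique representation basis $A \subseteq \mathbb{Z}$ for the integers such that $A(-x,x) \ge \left(\frac{\sqrt{2}}{2}-\varepsilon\right)\sqrt{x}$ for infinitely many $x$.
   Context: For $A \subseteq \mathbb{Z}$ and $n \in \mathbb{Z}$, let $r_A(n)$ be the number of pairs $(a,a')$ with $a,a' \in A$, $a \le a'$ and $a+a'=n$. A set $A \subseteq \mathbb{Z}$ is a unique representation basis for the integers if $r_A(n)=1$ for every $n \in \mathbb{Z}$. For real $y \le x$, $A(y,x) = |A \cap [y,x]|$. *)

(* Defs.v *)
From HB Require Import structures.
From mathcomp Require Import all_boot all_order all_algebra finmap.
From mathcomp Require Import boolp classical_sets cardinality reals.
Set Implicit Arguments.
Unset Strict Implicit.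
Unset Printing Implicit Defensive.
Import Order.TTheory GRing.Theory Num.Theory.
Local Open Scope classical_set_scope.
Local Open Scope ring_scope.

Definition rep_pairs (A : set int) (n : int) : set (int * int) :=
  [set p | [/\ A p.1, A p.2, p.1 <= p.2 & p.1 + p.2 = n]].

(* [fset_set] sends an infinite set to the empty one, so r_A(n) takes the junk
   value 0 when there are infinitely many pairs; this never affects the
   condition r_A(n) = 1. *)
Definition r_ (A : set int) (n : int) : nat := #|` fset_set (rep_pairs A n)|.

Definition unique_representation_basis (A : set int) : Prop :=
  forall n : int, r_ A n = 1%N.

(* The set A ∩ [y, x] is always finite, so its [fset_set] is exact. *)
Definition counting_fun (R : realType) (A : set int) (y x : R) : nat :=
  #|` fset_set [set a : int | A a /\ y <= a%:~R <= x]|.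

(* Main.v *)
Require Import Defs.
From HB Require Import structures.
From mathcomp Require Import all_boot all_order all_algebra finmap.
From mathcomp Require Import boolp classical_sets cardinality reals.
From mathcomp Require Import cyclic finfield zify ring lra.
Import Order.TTheory GRing.Theory Num.Theory.
Local Open Scope classical_set_scope.
Local Open Scope ring_scope.

(** A basis is built as the union of an increasing chain of finite Sidon sets.
    Starting from a finite Sidon set [B] inside [[-M, M]], a missing integer [n]
    is represented by adjoining [u] and [n - u] with [u] huge.  For the density,
    take a prime [p] and Ruzsa's set of [p - 1] integers in [[0, p (p - 1))]:
    the elements congruent to [i] modulo [p - 1] and to [z ^ i] modulo [p], with
    [z] a primitive root.  It is Sidon because the sum and the product of
    [z ^ i] and [z ^ j] determine the pair.  Translated by [p (p - 1) + 5 M],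
    its elements satisfy [s + s' - s'' > M], so the only possible conflicts with
    [B] are [s - s' = b - b']; at most [2 M] deletions remove them, and about
    [p = sqrt (x / 2)] elements remain in [[-x, x]] with [x = 2 p ^ 2]. *)

Definition sidon (A : set int) : Prop :=
  forall a b c d, A a -> A b -> A c -> A d -> a + b = c + d ->
    (a = c /\ b = d) \/ (a = d /\ b = c).

(** * Ruzsa's Sidon set *)

Lemma Fp_prim_root (p : nat) :
  prime p -> exists z : 'F_p, p.-1.-primitive_root z.
Proof.
move=> p_pr; pose rs := [seq x <- enum 'F_p | x != 0].
have p1_gt0 : (0 < p.-1)%N by rewrite -ltnS prednK ?prime_gt0 ?prime_gt1.
have /hasP[z _ zP] : has p.-1.-primitive_root rs; last by exists z.
apply: has_prim_root => //.
- apply/allP => x; rewrite mem_filter => /andP[x0 _]; rewrite unity_rootE.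
  have xp : x ^+ p = x by rewrite -{2}(expf_card x) card_Fp.
  by apply/eqP; apply: (mulfI x0); rewrite -exprS prednK ?prime_gt0 // mulr1.
- by rewrite filter_uniq ?enum_uniq.
- have -> : size rs = #|[pred x : 'F_p | x != 0]|.
    rewrite cardE /rs /enum_mem -filter_predI; congr size.
    by apply: eq_filter => x; rewrite /= andbT.
  have := cardC1 (0 : 'F_p); rewrite card_Fp // => <-.
  by apply: eq_leq; apply: eq_card.
Qed.

Lemma ruzsa_sidon (p : nat) : prime p ->
  exists S : seq int, [/\ uniq S, size S = p.-1, sidon [set` S] &
    forall s, s \in S -> 0 <= s < (p * p.-1)%:Z].
Proof.
move=> p_pr; have [z zP] := Fp_prim_root p p_pr.
have p_gt1 := prime_gt1 p_pr.
have cop : coprime p p.-1 by rewrite -{1}(prednK (ltnW p_gt1)) coprimeSn.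
have p1_gt0 : (0 < p.-1)%N by lia.
pose f i := (chinese p p.-1 (z ^+ i)%R i %% (p * p.-1))%N.
have f1 i : (f i)%:R = z ^+ i :> 'F_p.
  rewrite -(Fp_nat_mod p_pr) /f modn_dvdm ?dvdn_mulr // chinese_modl //.
  by rewrite (Fp_nat_mod p_pr) natr_Zp.
have f2 i : (f i = i %[mod p.-1])%N.
  by rewrite /f modn_dvdm ?dvdn_mull // chinese_modr.
(* As [z] has order [p.-1], an equality between sums of values of [f] turns into one between
   products of powers of [z]. *)
have f3 i : z ^+ f i = z ^+ i by apply/eqP; rewrite (eq_prim_root_expr zP) f2.
have f4 i : (f i < p * p.-1)%N by rewrite ltn_mod muln_gt0 ltnW.
have fz i j : z ^+ i = z ^+ j -> f i = f j.
  move=> zij; rewrite -(modn_small (f4 i)) -(modn_small (f4 j)); apply/eqP.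
  rewrite chinese_remainder //; apply/andP; split.
    by rewrite -!(val_Fp_nat p_pr) !f1 zij.
  by rewrite -(eq_prim_root_expr zP) !f3 zij.
exists [seq (f i)%:Z | i <- iota 0 p.-1]; split.
- rewrite map_inj_in_uniq ?iota_uniq // => i j; rewrite !mem_iota => /= hi hj [fij].
  by rewrite -(modn_small hi) -(modn_small hj) -f2 fij f2.
- by rewrite size_map size_iota.
- move=> _ _ _ _ /= /mapP[i _ ->] /mapP[j _ ->] /mapP[k _ ->] /mapP[l _ ->].
  move=> [fE].
  have zD : z ^+ i + z ^+ j = z ^+ k + z ^+ l by rewrite -!f1 -!natrD fE.
  have zM : z ^+ i * z ^+ j = z ^+ k * z ^+ l.
    by rewrite -(f3 i) -(f3 j) -(f3 k) -(f3 l) -!exprD fE.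
  (* The two pairs share their sum and product, so [z ^+ i] is a root of the quadratic with roots
     [z ^+ k] and [z ^+ l]. *)
  have : (z ^+ i - z ^+ k) * (z ^+ i - z ^+ l) = 0.
    have -> : (z ^+ i - z ^+ k) * (z ^+ i - z ^+ l) =
      z ^+ i * (z ^+ i - (z ^+ k + z ^+ l)) + z ^+ k * z ^+ l by ring.
    by rewrite -zD -zM; ring.
  move/eqP; rewrite mulf_eq0 !subr_eq0 => /orP[]/eqP/fz; lia.
- by move=> _ /mapP[i _ ->]; have := f4 i; lia.
Qed.

(** * Extensions of a finite Sidon set *)

Lemma seq_int_bounded (B : seq int) :
  exists M : nat, forall b, b \in B -> - M%:Z <= b <= M%:Z.
Proof.
exists (\sum_(b <- B) `|b|)%N => b bB.
have : (`|b| <= \sum_(b <- B) `|b|)%N by rewrite (big_rem b) //= leq_addr.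
lia.
Qed.

Lemma sidon_add_sum (B : seq int) (n : int) : sidon [set` B] ->
  exists C : seq int, [/\ {subset B <= C}, sidon [set` C] &
    exists a b, [/\ a \in C, b \in C & a + b = n]].
Proof.
move=> sB.
have [[a [b [aB bB abn]]]|nB] :=
    pselect (exists a b, [/\ a \in B, b \in B & a + b = n]).
  by exists B; split => //; exists a, b.
have [M hM] := seq_int_bounded B.
(* So large that sums are sorted by their coefficient of [u], from -2 to 2. Only coefficient 0
   arises in two ways, from [u + (n - u) = n] and from sums over [B]; but [n] is no sum over [B]. *)
pose u : int := (10 * M + 10 * `|n| + 10)%N%:Z.
have {}nB a b : a \in B -> b \in B -> a + b <> n.
  by move=> aB bB abn; apply: nB; exists a, b.
exists [:: u, n - u & B]; split.
- by move=> x xB; rewrite !inE xB !orbT.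
- have memC x : x \in [:: u, n - u & B] ->
      (x \in B /\ - M%:Z <= x <= M%:Z) \/ x = u \/ x = n - u.
    rewrite !inE => /or3P[/eqP|/eqP|xB]; [by right; left|by right; right|].
    by left; split => //; exact: hM.
  move=> a b c d /= /memC ha /memC hb /memC hc /memC hd abcd.
  case: ha => [[aB ha]|ha]; case: hb => [[bB hb]|hb];
    case: hc => [[cB hc]|hc]; case: hd => [[dB hd]|hd];
    try (have := nB _ _ aB bB); try (have := nB _ _ cB dB);
    [by move=> _ _; apply: sB| rewrite /u in ha hb hc hd *; lia..].
- by exists u, (n - u); split; rewrite ?inE ?eqxx ?orbT // addrC subrK.
Qed.

(** In a Sidon set each difference from 1 to [K] comes from at most one pair, so deleting the larger
    element of each such pair costs at most [K] elements. *)
Lemma sidon_separate (S : seq int) (K : nat) : uniq S -> sidon [set` S] ->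
  exists S' : seq int, [/\ uniq S', {subset S' <= S}, (size S <= size S' + K)%N &
    forall s t, s \in S' -> t \in S' -> s < t -> K%:Z < t - s].
Proof.
move=> uS sS.
pose bad t := has (fun s => (s < t) && (t - s <= K%:Z)) S.
exists [seq t <- S | ~~ bad t]; split.
- exact: filter_uniq.
- by move=> x; rewrite mem_filter => /andP[].
- rewrite -(count_predC (predC bad) S) size_filter leq_add2l.
  rewrite (@eq_count _ _ bad); last by move=> x /=; rewrite negbK.
  pose w t := nth 0 S (find (fun s => (s < t) && (t - s <= K%:Z)) S).
  have wP t : bad t -> [/\ w t \in S, w t < t & t - w t <= K%:Z].
    move=> bt; have /andP[? ?] := nth_find 0 bt.
    by split=> //; rewrite mem_nth // -has_find.
  rewrite -size_filter -(size_map (fun t => `|t - w t|%N)) -[leqRHS](size_iota 1 K).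
  apply: uniq_leq_size.
    rewrite map_inj_in_uniq ?filter_uniq // => s t.
    rewrite !mem_filter => /andP[/wP[? ? ?] sS'] /andP[/wP[? ? ?] tS'] st.
    have : s + w t = t + w s by lia.
    by move/sS => /(_ sS')[] //; lia.
  move=> _ /mapP[t + ->]; rewrite mem_filter => /andP[/wP[? ? ?] _].
  by rewrite mem_iota; lia.
- move=> s t; rewrite !mem_filter => /andP[_ sS'] /andP[bt _] st.
  rewrite ltNge; apply: contra bt => ts; apply/hasP; exists s => //.
  by rewrite st.
Qed.

Lemma sidon_add_block (B : seq int) : sidon [set` B] ->
  exists K : nat, forall p, prime p -> (K <= p)%N ->
  exists C S : seq int, [/\ {subset B <= C}, sidon [set` C],
    uniq S, {subset S <= C} & (p <= size S + K)%N /\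
    forall s, s \in S -> - (2 * p ^ 2)%N%:Z <= s <= (2 * p ^ 2)%N%:Z].
Proof.
move=> sB; have [M hM] := seq_int_bounded B.
(* At most [2 * M + 1] elements are missing from [p]: the deletions, and one since Ruzsa's set has
   size [p.-1]. The bound [5 * M <= p] keeps the translated block below [2 * p ^ 2]. *)
exists (5 * M + 1)%N => p p_pr pK.
have [S0 [uS0 szS0 sS0 hS0]] := ruzsa_sidon p p_pr.
have [S1 [uS1 S10 szS1 sepS1]] := sidon_separate S0 (2 * M) uS0 sS0.
pose P := (p * p.-1)%N; pose t : int := (P + 5 * M)%N%:Z.
have hS x : x \in S1 -> 0 <= x < P%:Z by move/S10/hS0.
exists (B ++ [seq s + t | s <- S1]), [seq s + t | s <- S1]; split.
- by move=> x xB; rewrite mem_cat xB.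
- have memC x : x \in B ++ [seq s + t | s <- S1] ->
      (x \in B /\ - M%:Z <= x <= M%:Z) \/
      (exists s, [/\ s \in S1, 0 <= s < P%:Z & x = s + t]).
    rewrite mem_cat => /orP[xB|/mapP[s sS ->]]; [left|right].
      by split=> //; exact: hM.
    by exists s; split=> //; exact: hS.
  move=> a b c d /= /memC ha /memC hb /memC hc /memC hd abcd.
  have sep x y : x \in S1 -> y \in S1 ->
      x = y \/ (2 * M)%N%:Z < x - y \/ (2 * M)%N%:Z < y - x.
    move=> xS yS; case: (ltgtP x y) => xy; [right; right|right; left|by left];
    exact: sepS1.
  have tE : t = (P + 5 * M)%N%:Z by [].
  (* By size, both sides have equally many terms in the block. With none, [B] is Sidon; with one,
     nonzero differences in [S1] exceed those in [B]; with two, [S0] is Sidon. *)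
  case: ha => [[aB ha]|[a' [aS ha aE]]]; case: hb => [[bB hb]|[b' [bS hb bE]]];
  case: hc => [[cB hc]|[c' [cS hc cE]]]; case: hd => [[dB hd]|[d' [dS hd dE]]];
  try (have := sep _ _ aS cS); try (have := sep _ _ aS dS);
  try (have := sep _ _ bS cS); try (have := sep _ _ bS dS); try lia.
  + by move=> *; apply: sB.
  + move=> _ _ _ _; have : a' + b' = c' + d' by lia.
    by move/sS0; rewrite /= => /(_ (S10 _ aS) (S10 _ bS) (S10 _ cS) (S10 _ dS)); lia.
- by rewrite map_inj_uniq //; exact: addIr.
- by move=> x xS; rewrite mem_cat xS orbT.
- split; first by move: szS1; rewrite size_map szS0; set m := size _; lia.
  by move=> _ /mapP[s sS ->]; have := hS _ sS; rewrite /t /P; nia.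
Qed.

(** * Density at a large scale *)

(** A witness list, rather than a count, passes unchanged to any larger [C]. *)
Definition dense_at (R : realType) (eps : R) (C : seq int) (x : nat) : Prop :=
  exists S : seq int, [/\ uniq S, {subset S <= C},
    forall s, s \in S -> - x%:Z <= s <= x%:Z &
    (Num.sqrt 2 / 2 - eps) * Num.sqrt x%:R <= (size S)%:R :> R].

Lemma sidon_add_dense (R : realType) (eps : R) (B : seq int) (k : nat) :
  0 < eps -> sidon [set` B] ->
  exists C : seq int, [/\ {subset B <= C}, sidon [set` C] &
    exists2 x, (k <= x)%N & dense_at R eps C x].
Proof.
move=> eps0 /sidon_add_block[K hK].
(* The summands ensure in turn [k <= 2 * p ^ 2], [K <= p] and [K <= eps * p]. *)
have [p pN p_pr] := prime_above (k + K + Num.bound (K%:R / eps)).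
have pk : (k <= 2 * p ^ 2)%N by nia.
have [|C [S [BC sC uS SC [szS hS]]]] := hK p p_pr; first by lia.
exists C; split => //; exists (2 * p ^ 2)%N => //; exists S; split => //.
have p0 : 0 <= p%:R :> R by [].
have Kp : K%:R <= eps * p%:R :> R.
  rewrite -ler_pdivrMl // mulrC.
  apply: le_trans (ltW (archi_boundP _)) _; first by rewrite divr_ge0 // ltW.
  by rewrite ler_nat; apply: leq_trans (ltnW pN); rewrite leq_addl.
rewrite natrM natrX sqrtrM // sqrtr_sqr ger0_norm //.
have s2 : 1 <= Num.sqrt 2 :> R by rewrite -{1}sqrtr1 ler_sqrt // ler1n.
have s22 : Num.sqrt 2 * Num.sqrt 2 = 2 :> R by rewrite -expr2 sqr_sqrtr.
(* The target is [p - sqrt 2 * eps * p], and the loss [K] is at most [eps * p]. *)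
have -> : (Num.sqrt 2 / 2 - eps) * (Num.sqrt 2 * p%:R) =
    (Num.sqrt 2 * Num.sqrt 2) / 2 * p%:R - Num.sqrt 2 * (eps * p%:R) :> R by ring.
have : p%:R <= (size S)%:R + K%:R :> R by rewrite -natrD ler_nat.
have : eps * p%:R <= Num.sqrt 2 * (eps * p%:R) by rewrite ler_peMl // mulr_ge0 // ltW.
rewrite s22; lra.
Qed.

(** * Representations and counts in the limit set *)

Lemma sidon_rep_unique (A : set int) (n : int) : sidon A ->
  (exists a b, [/\ A a, A b & a + b = n]) -> r_ A n = 1%N.
Proof.
move=> sA [a [b [Aa Ab abn]]].
wlog ab : a b Aa Ab abn / a <= b.
  move=> H; case: (leP a b) => [/(H a b)|/ltW/(H b a)]; apply=> //.
  by rewrite addrC.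
rewrite /r_; suff -> : rep_pairs A n = [set (a, b)].
  by rewrite fset_set1 cardfs1.
apply/seteqP; split => [[c d] [/= Ac Ad cd cdn]|_ ->]; last by split.
have : c + d = a + b by rewrite cdn.
(* In the swapped case the two orderings force all four integers to coincide. *)
by move/sA => /(_ Ac Ad Aa Ab)[[-> ->//]|[? ?]]; congr pair; lia.
Qed.

Lemma dense_at_counting (R : realType) (eps : R) (A : set int) (C : seq int)
    (x : nat) : [set` C] `<=` A -> dense_at R eps C x ->
  (Num.sqrt 2 / 2 - eps) * Num.sqrt x%:R
    <= (counting_fun A (- x%:R : R) x%:R)%:R.
Proof.
move=> CA [S [uS SC hS]] /le_trans; apply; rewrite ler_nat /counting_fun.
set X := [set a | _].
have xE (a : int) :
    (- x%:R <= (a%:~R : R) <= x%:R) = (- x%:Z <= a <= x%:Z).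
  have xZ : x%:R = x%:Z%:~R :> R by [].
  by rewrite xZ -mulrNz !ler_int.
have finX : finite_set X.
  apply: (@sub_finite_set int _ [set` [seq i%:Z - x%:Z | i <- iota 0 (x + x + 1)]]);
    last exact: finite_seq.
  move=> a [_]; rewrite xE /= => ax; apply/mapP; exists (absz (a + x%:Z)); last lia.
  by rewrite mem_iota; lia.
rewrite -{1}(undup_id uS) -card_fseq; apply: fsubset_leq_card.
apply/fsubsetP => a; rewrite in_fset in_fset_set // => aS; rewrite inE.
by split; [exact/CA/SC|rewrite xE hS].
Qed.

Lemma unbounded_infinite (X : set nat) :
  (forall k, exists2 x, (k <= x)%N & X x) -> infinite_set X.
Proof.
move=> H /finite_seqP[s XE].
have [x] := H (\sum_(i <- s) i).+1; rewrite XE /= => + xs.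
by rewrite (big_rem x) //= ltnNge leq_addr.
Qed.

Theorem theorem1p2 (R : realType) (eps : R) (heps : 0 < eps) :
  exists A : set int,
    unique_representation_basis A /\
    infinite_set [set x : nat |
      (Num.sqrt 2 / 2 - eps) * Num.sqrt x%:R
        <= (counting_fun A (- x%:R : R) x%:R)%:R].
Proof.
(* One stage of the chain: stage [k] represents the integer coded by [k] and is dense at some scale
   beyond [k]. Keeping the Sidon condition as a premise makes [next] a total function. *)
pose good (kB : nat * seq int) (C : seq int) := sidon [set` kB.2] ->
  [/\ {subset kB.2 <= C}, sidon [set` C],
    forall n : int, choice.unpickle kB.1 = Some n ->
      exists a b, [/\ a \in C, b \in C & a + b = n] &
    exists2 x, (kB.1 <= x)%N & dense_at R eps C x].
have /choice[next nextP] : forall kB, exists C, good kB C.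
  move=> [k B]; have [sB|nsB] := pselect (sidon [set` B]); last by exists [::].
  have [C [BC sC dC]] := sidon_add_dense R eps B k heps sB.
  (* If [k] codes no integer, the stage represents 0 instead, which is harmless. *)
  pose n := odflt 0 (choice.unpickle k : option int).
  have [D [CD sD [a [b [aD bD abn]]]]] := sidon_add_sum C n sC.
  exists D => _; split => //=.
  - by move=> x /BC/CD.
  - by move=> m mE; exists a, b; split => //; rewrite abn /n mE.
  - have [x kx [S [uS SC hS szS]]] := dC; exists x => //.
    by exists S; split => // s /SC/CD.
pose B := fix B k := if k is k'.+1 then next (k', B k') else [::].
have sB k : sidon [set` B k].
  by elim: k => [|k IH] /=; [move=> ? ? ? ?|have [] := nextP (k, B k) IH].
have BP k := nextP (k, B k) (sB k).
have Bmono : {homo B : i j / (i <= j)%N >-> {subset i <= j}}.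
  apply: homo_leq => [? ? //|? ? ? h1 h2 x /h1/h2 //|k].
  by have [] := BP k.
exists [set a | exists k, a \in B k]; split.
- move=> n; apply: sidon_rep_unique.
    move=> a b c d [i ai] [j bj] [k ck] [l dl].
    apply: (sB (i + j + k + l)%N) => /=.
    + by apply: Bmono ai; lia.
    + by apply: Bmono bj; lia.
    + by apply: Bmono ck; lia.
    + by apply: Bmono dl; lia.
  have [_ _ /(_ n (choice.pickleK n))[a [b [aB bB abn]]] _] := BP (choice.pickle n).
  by exists a, b; split => //; exists (choice.pickle n).+1.
- apply: unbounded_infinite => k; have [_ _ _ [x kx dx]] := BP k.
  exists x => //; apply: dense_at_counting dx => a aB.
  by exists k.+1.
Qed.
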